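(* Let $V$ be a vertex operator algebra and let $\tau\in\mathrm{Aut}(V)$ be of period $T$ (i.e. $T$ is a positive integer with $\tau^T=1$). Let $M_2,M_3$ be weak $\tau$-twisted $V$-modules and let $M$ be any weak $V$-module. Then for any intertwining operator $I(\cdot,x)$ of type $\binom{M_3}{M\ M_2}$, we have $I(w,x)\in\mathcal H(M_2,M_3)$ for $w\in M$, and the map $f_I$ defined by $f_I(w)=I(w,x)$ for $w\in M$ is a homomorphism of weak $V$-modules (from $M$ to $\mathcal H(M_2,M_3)$). Furthermore, the linear map $$\theta: I_{V}\binom{M_3}{M\ M_{2}}\rightarrow \mathrm{Hom}_{V}(M,\mathcal{H}(M_{2},M_{3}))$$ defined by $\theta(I)=f_I$ is a linear isomorphism.
   Context: Notation: $U\{x\}$ denotes formal series $\sum_{\alpha\in\mathbb C}u_\alpha x^\alpha$ with $u_\alpha\in U$; $\delta(z)=\sum_{n\in\mathbb Z}z^n$; powers of binomials are expanded in nonnegative powers of the second variable. $V^r=\{v\in V:\tau v=e^{2\pi ir/T}v\}$. A weak $\tau$-twisted $V$-module is a space $M$ with a linear map $Y_M(\cdot,z):V\to(\mathrm{End}\,M)[[z^{1/T},z^{-1/T}]]$ such that for $u\in V^r$ ($0\le r\le T-1$), $v\in V$, $w\in M$: $Y_M(u,z)=\sum_{n\in r/T+\mathbb Z}u_nz^{-n-1}$; $u_nw=0$ for $n$ sufficiently large; $Y_M(\mathbf 1,z)=\mathrm{Id}$; and $z_0^{-1}\delta(\frac{z_1-z_2}{z_0})Y_M(u,z_1)Y_M(v,z_2)-z_0^{-1}\delta(\frac{z_2-z_1}{-z_0})Y_M(v,z_2)Y_M(u,z_1)=z_2^{-1}(\frac{z_1-z_0}{z_2})^{-r/T}\delta(\frac{z_1-z_0}{z_2})Y_M(Y(u,z_0)v,z_2)$.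 A weak $V$-module is the case $\tau=1$. $I_V\binom{M_3}{M\ M_2}$ is the space of intertwining operators of type $\binom{M_3}{M\ M_2}$: linear maps $\mathcal Y(\cdot,z):M\to(\mathrm{Hom}(M_2,M_3))\{z\}$, $w\mapsto\sum_{n\in\mathbb C}w_nz^{-n-1}$, such that for any $w\in M$, $w^2\in M_2$ and any fixed $c\in\mathbb C$: $w_{c+n}w^2=0$ for $n\in\mathbb Q$ sufficiently large; $\frac{d}{dz}\mathcal Y(w,z)=\mathcal Y(L(-1)w,z)$; and for $u\in V^r$, $r\in\mathbb Z$, on $M_2$, $z_0^{-1}\delta(\frac{z_1-z_2}{z_0})Y_{M_3}(u,z_1)\mathcal Y(w,z_2)-z_0^{-1}\delta(\frac{z_2-z_1}{-z_0})\mathcal Y(w,z_2)Y_{M_2}(u,z_1)=z_2^{-1}(\frac{z_1-z_0}{z_2})^{-r/T}\delta(\frac{z_1-z_0}{z_2})\mathcal Y(Y_M(u,z_0)w,z_2)$. $\mathcal H(M_2,M_3)$ is the space of generalized intertwining operators from $M_2$ to $M_3$: elements $\phi(x)=\sum_{\alpha\in\mathbb C}\phi_\alpha x^{-\alpha-1}\in(\mathrm{Hom}(M_2,M_3))\{x\}$ such that (G1) for any $\alpha\in\mathbb C$, $w\in M_2$, $\phi_{\alpha+n}w=0$ for $n\in\mathbb Z$ sufficiently large; (G2) $[L(-1),\phi(x)]=\frac{d}{dx}\phi(x)$; (G3) for any $v\in V$ there is a nonnegative integer $k$ with $(x_1-x_2)^kY_{M_3}(v,x_1)\phi(x_2)=(x_1-x_2)^k\phi(x_2)Y_{M_2}(v,x_1)$.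 For $u\in V^r$ with $0\le r<T$, $\phi(x)\in\mathcal H(M_2,M_3)$ and $n\in\mathbb Z$, define $u_n^{\mathcal H}\phi(x)=\mathrm{Res}_{x_1}\sum_{j\ge0}\binom{-r/T}{j}x^{-\frac rT-j}x_1^{\frac rT}\left((x_1-x)^{n+j}Y_{M_3}(u,x_1)\phi(x)-(-x+x_1)^{n+j}\phi(x)Y_{M_2}(u,x_1)\right)$, extend linearly to $u\in V$, and put $Y_{\mathcal H}(u,z)\phi(x)=\sum_{n\in\mathbb Z}u_n^{\mathcal H}\phi(x)z^{-n-1}$. With $Y_{\mathcal H}$, $\mathcal H(M_2,M_3)$ is a weak $V$-module. $\mathrm{Hom}_V$ denotes homomorphisms of weak $V$-modules.
   Formalization: In the definition of intertwining operator, the bound in ''w_{c+n}w^2=0 for n in Q sufficiently large'' may depend on the denominator of n; with one bound for all rational n, surjectivity of θ fails (infinite sums of Heisenberg Fock modules). *)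

(* Defs.v *)
From HB Require Import structures.
From mathcomp Require Import all_boot all_order all_algebra.
From mathcomp Require Import zify ring complex.
From mathcomp Require Import boolp classical_sets functions fsbigop reals trigo.

Set Implicit Arguments.
Unset Strict Implicit.
Unset Printing Implicit Defensive.

Import Order.TTheory GRing.Theory Num.Theory.

Local Open Scope ring_scope.
Local Open Scope complex_scope.
Local Open Scope classical_set_scope.

(* The ground field is C = R[i] for an arbitrary R : realType.

   A formal series  sum_a f_a x^(-a-1),  a ranging over C, is represented by
   the function a |-> f_a; vertex operators on V, which only involve integral
   powers, are represented by their modes indexed by int.

   Infinite sums over i : nat are finitely supported sums
   \sum_(i \in [set: nat]) F i; those below have finite support once they
   are applied to a vector, by the truncation axioms (and, for the sum over j
   in sector_Hmode, by weak commutativity). *)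

Section FormalCalculus.
Variable R : realType.
Local Notation C := R[i].

(* a (a-1) ... (a-j+1) / j! *)
Definition binc (a : C) (j : nat) : C := (\prod_(i < j) (a - i%:R)) / j`!%:R.

(* the modes of f whose index lies in a + Z *)
Definition coset (W : Type) (a : C) (f : C -> W) (n : int) : W := f (a + n%:~R).

Definition eventually0 (W : zmodType) (f : int -> W) : Prop :=
  exists N : int, forall n, N <= n -> f n = 0.

(* Jacobi identity, as equality of the coefficients of
   z0^(-n-1) z1^(-rho-m-1) z2^(-kappa-k-1), where the four series are
     A(z1)     = sum_m A_m z1^(-rho-m-1)   acting on M3,
     B(z1)     = sum_m B_m z1^(-rho-m-1)   acting on M2,
     Phi(z2)   = sum_k Phi_k z2^(-kappa-k-1)   from M2 to M3,
     W(z0,z2)  = sum_(q,l) (W q l) z0^(-q-1) z2^(-rho-kappa-l-1).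
   The three kernels are expanded as
     z0^-1 delta((z1-z2)/z0)  = sum_n z0^(-n-1) (z1-z2)^n,
     z0^-1 delta((z2-z1)/-z0) = sum_n (-1)^n z0^(-n-1) (z2-z1)^n,
     z2^-1 ((z1-z0)/z2)^(-rho) delta((z1-z0)/z2)
                              = sum_p z2^(-p+rho-1) (z1-z0)^(p-rho),
   and in the last one z1^(-rho-m-1) z0^i comes from p-rho = i-(rho+m)-1.
   The base points rho and kappa are supplied by the use sites; coefficients
   of z1^(-b-1) with b outside rho + Z vanish on both sides. *)
Definition jacobi (M2 M3 : lmodType C) (rho : C)
    (A : int -> M3 -> M3) (B : int -> M2 -> M2)
    (Phi : int -> M2 -> M3) (W : int -> int -> M2 -> M3) : Prop :=
  forall (n m k : int) (x : M2),
    \sum_(i \in [set: nat])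
       ((-1) ^+ i * binc n%:~R i) *: A (m + n - i%:Z) (Phi (k + i%:Z) x)
  - \sum_(i \in [set: nat])
       ((-1) ^ n * (-1) ^+ i * binc n%:~R i)
          *: Phi (k + n - i%:Z) (B (m + i%:Z) x)
  = \sum_(i \in [set: nat])
       ((-1) ^+ i * binc (i%:R - (rho + m%:~R) - 1) i)
          *: W (n + i%:Z) (m + k - i%:Z) x.

Definition fin0 (W : zmodType) (F : nat -> W) : Prop :=
  exists N : nat, forall i, (N <= i)%N -> F i = 0.

Lemma fsum_trunc (W : zmodType) (F : nat -> W) N :
  (forall i, (N <= i)%N -> F i = 0) ->
  \sum_(i \in [set: nat]) F i = \sum_(i < N) F i.
Proof.
move=> F0; rewrite fsbig_ord; apply/esym/fsbig_widen => // i [_ /= iN].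
by apply: F0; rewrite leqNgt; apply/negP.
Qed.

Lemma fin0_lin (K : pzRingType) (W : lmodType K) (F G : nat -> W) (a : K) :
  fin0 F -> fin0 G -> fin0 (fun i => a *: F i + G i).
Proof.
move=> [N FN] [P GP]; exists (maxn N P) => i; rewrite geq_max => /andP[Ni Pi].
by rewrite FN // GP // scaler0 addr0.
Qed.

Lemma fsum_lin (K : pzRingType) (W : lmodType K) (F G : nat -> W) (a : K) :
  fin0 F -> fin0 G ->
  \sum_(i \in [set: nat]) (a *: F i + G i)
    = a *: \sum_(i \in [set: nat]) F i + \sum_(i \in [set: nat]) G i.
Proof.
move=> [N FN] [P GP].
have FM i : (maxn N P <= i)%N -> F i = 0 by rewrite geq_max => /andP[/FN].
have GM i : (maxn N P <= i)%N -> G i = 0 by rewrite geq_max => /andP[_ /GP].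
rewrite (fsum_trunc FM) (fsum_trunc GM) (@fsum_trunc _ _ (maxn N P)).
  by rewrite big_split /= scaler_sumr.
by move=> i Mi; rewrite FM // GM // scaler0 addr0.
Qed.

Lemma eventually0_lin (K : pzRingType) (W : lmodType K) (f g : int -> W) (a : K) :
  eventually0 f -> eventually0 g -> eventually0 (fun n => a *: f n + g n).
Proof.
move=> [N fN] [P gP]; exists (Num.max N P) => n; rewrite ge_max => /andP[Nn Pn].
by rewrite fN // gP // scaler0 addr0.
Qed.

Lemma eventually0_ge (W : zmodType) (f : int -> W) :
  eventually0 f -> forall n : int, exists N : nat,
  forall i : nat, (N <= i)%N -> f (n + i%:Z) = 0.
Proof.
move=> [N fN] n; exists `|N - n|%N => i Ni; apply: fN.
rewrite -lerBlDl (le_trans (ler_norm _)) //.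
Qed.

Lemma binc_nat (N i : nat) : binc N%:R i = 'C(N, i)%:R.
Proof.
rewrite /binc; have fi0 : i`!%:R != 0 :> C by rewrite pnatr_eq0 -lt0n fact_gt0.
apply: (mulIf fi0); rewrite divfK // -natrM bin_ffact.
elim: i {fi0} => [|i IHi]; first by rewrite big_ord0.
rewrite big_ord_recr /= IHi ffactnSr natrM.
have [iN|Ni] := leqP i N; first by rewrite natrB.
by rewrite ffact_small // !mul0r.
Qed.

Lemma jacobi_lin (M2 M3 : lmodType C) (rho : C)
    (A : int -> M3 -> M3) (B : int -> M2 -> M2)
    (Phi Psi : int -> M2 -> M3) (W X : int -> int -> M2 -> M3) (a : C) :
  (forall m, linear (A m)) ->
  (forall k, linear (Phi k)) -> (forall k, linear (Psi k)) ->
  (forall x, eventually0 (Phi ^~ x)) -> (forall x, eventually0 (Psi ^~ x)) ->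
  (forall x, eventually0 (B ^~ x)) ->
  (exists N, forall q, N <= q -> forall l x, W q l x = 0) ->
  (exists N, forall q, N <= q -> forall l x, X q l x = 0) ->
  jacobi rho A B Phi W -> jacobi rho A B Psi X ->
  jacobi rho A B (fun k x => a *: Phi k x + Psi k x)
     (fun q l x => a *: W q l x + X q l x).
Proof.
move=> AL PL QL P0 Q0 B0 W0 X0 JP JQ n m k x.
have AZ i : A i 0 = 0 by have := AL i (-1) 0 0; rewrite scaler0 addr0 scaleN1r addNr.
have FL (F : int -> M2 -> M3) : (forall k, linear (F k)) -> forall i, F i 0 = 0.
  by move=> H i; have := H i (-1) 0 0; rewrite scaler0 addr0 scaleN1r addNr.
have f1 (F : int -> M2 -> M3) : (forall x, eventually0 (F ^~ x)) ->
    fin0 (fun i : nat => ((-1) ^+ i * binc n%:~R i)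
                           *: A (m + n - i%:Z) (F (k + i%:Z) x)).
  move=> F0; have [N FN] := eventually0_ge (F0 x) k.
  by exists N => i Ni; rewrite FN // AZ scaler0.
have f2 (F : int -> M2 -> M3) : (forall k, linear (F k)) ->
    fin0 (fun i : nat => ((-1) ^ n * (-1) ^+ i * binc n%:~R i)
                           *: F (k + n - i%:Z) (B (m + i%:Z) x)).
  move=> F0; have [N BN] := eventually0_ge (B0 x) m.
  by exists N => i Ni; rewrite BN // FL // scaler0.
have f3 (F : int -> int -> M2 -> M3) :
    (exists N, forall q, N <= q -> forall l x, F q l x = 0) ->
    fin0 (fun i : nat => ((-1) ^+ i * binc (i%:R - (rho + m%:~R) - 1) i)
                           *: F (n + i%:Z) (m + k - i%:Z) x).
  move=> [N FN]; have F0 : eventually0 (fun q => (fun l => F q l x) : int -> M3).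
    by exists N => q Nq; apply/funext => l; exact: FN.
  have [P FP] := eventually0_ge F0 n; exists P => i Pi.
  by have /(congr1 (fun f => f (m + k - i%:Z))) := FP i Pi => /= ->; rewrite scaler0.
transitivity (a *: (\sum_(i \in [set: nat])
         ((-1) ^+ i * binc n%:~R i) *: A (m + n - i%:Z) (Phi (k + i%:Z) x)
    - \sum_(i \in [set: nat]) ((-1) ^ n * (-1) ^+ i * binc n%:~R i)
          *: Phi (k + n - i%:Z) (B (m + i%:Z) x))
  + (\sum_(i \in [set: nat])
         ((-1) ^+ i * binc n%:~R i) *: A (m + n - i%:Z) (Psi (k + i%:Z) x)
    - \sum_(i \in [set: nat]) ((-1) ^ n * (-1) ^+ i * binc n%:~R i)
          *: Psi (k + n - i%:Z) (B (m + i%:Z) x))).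
  rewrite scalerBr addrACA -opprD -!fsum_lin; try by auto.
  by congr (_ - _); apply: eq_fsbigr => i _;
    rewrite ?AL scalerDr !scalerA [a * _]mulrC.
rewrite JP JQ -fsum_lin; try by auto.
by apply: eq_fsbigr => i _; rewrite scalerDr !scalerA [a * _]mulrC.
Qed.

End FormalCalculus.

Section Structures.
Variable R : realType.
Local Notation C := R[i].

(* Virasoro operators: Y(omega,z) = sum_n L(n) z^(-n-2).  The homogeneous
   space V_(n) is the eigenspace of L(0) for n, and the axioms say that V is
   the (automatically direct) sum of the V_(n), with dim V_(n) finite and
   V_(n) = 0 for n sufficiently negative. *)
Record voa := Voa {
  voa_sort :> lmodType C;
  vmode : voa_sort -> int -> voa_sort -> voa_sort;
  vac : voa_sort;
  conf : voa_sort;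
  vmode_linearl : forall n v, linear (fun u => vmode u n v);
  vmode_linearr : forall u n, linear (vmode u n);
  vmode_trunc : forall u v, eventually0 (fun n => vmode u n v);
  vac_mode : forall n v, vmode vac n v = if n == -1 then v else 0;
  vac_creation : forall u n, 0 <= n -> vmode u n vac = 0;
  vac_creationN1 : forall u, vmode u (-1) vac = u;
  voa_jacobi : forall u v, jacobi 0 (vmode u) (vmode u) (vmode v)
                                  (fun q => vmode (vmode u q v));
  virasoro : exists c : C, forall (m n : int) v,
    let L k := vmode conf (k + 1) in
    L m (L n v) - L n (L m v) = (m - n)%:~R *: L (m + n) v
      + (if m + n == 0 then ((m ^+ 3 - m)%:~R / 12%:R * c) *: v else 0);
  voa_deriv : forall u n v,
    vmode (vmode conf 0 u) n v = - (n%:~R *: vmode u (n - 1) v);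
  voa_grading : forall v, exists (s : seq int) (h : int -> voa_sort),
    (forall n, vmode conf 1 (h n) = n%:~R *: h n) /\ v = \sum_(n <- s) h n;
  voa_findim : forall n : int, exists (d : nat) (b : 'I_d -> voa_sort),
    forall v, vmode conf 1 v = n%:~R *: v ->
      exists a : 'I_d -> C, v = \sum_i a i *: b i;
  voa_bounded : exists N : int, forall n v, n < N ->
    vmode conf 1 v = n%:~R *: v -> v = 0
}.

(* e^(i x) *)
Definition expi (x : R) : C := cos x +i* sin x.

(* an automorphism tau of V with tau^T = 1, T > 0; T need not be the order *)
Record periodic_aut (V : voa) (T : nat) := PeriodicAut {
  aut_fun :> V -> V;
  aut_linear : linear aut_fun;
  aut_bij : bijective aut_fun;
  aut_mode : forall u n v, aut_fun (vmode u n v) = vmode (aut_fun u) n (aut_fun v);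
  aut_vac : aut_fun (vac V) = vac V;
  aut_conf : aut_fun (conf V) = conf V;
  period_gt0 : (0 < T)%N;
  aut_period : forall v, iter T aut_fun v = v
}.

(* V^r *)
Definition sector (V : voa) (T : nat) (tau : V -> V) (r : int) (v : V) : Prop :=
  tau v = expi (2 * pi * r%:~R / T%:R) *: v.

Definition rT (r : int) (T : nat) : C := r%:~R / T%:R.

(* the component in V^r of a vector of V, for 0 <= r < T *)
Definition sector_proj (V : voa) (T : nat) (tau : V -> V) (r : nat) (v : V) : V :=
  T%:R^-1 *: \sum_(s < T) expi (- (2 * pi * (r * s)%:R / T%:R)) *: iter s tau v.

Record twisted_module (V : voa) (T : nat) (tau : periodic_aut V T) :=
    TwistedModule {
  tm_sort :> lmodType C;
  tmode : V -> C -> tm_sort -> tm_sort;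
  tmode_linearl : forall a w, linear (fun u => tmode u a w);
  tmode_linearr : forall u a, linear (tmode u a);
  tmode_support : forall (r : nat) u (a : C) w, (r < T)%N ->
    sector T tau r u -> (forall n : int, a <> rT r T + n%:~R) ->
    tmode u a w = 0;
  tmode_trunc : forall (r : nat) u w, (r < T)%N -> sector T tau r u ->
    eventually0 (coset (rT r T) (fun a => tmode u a w));
  tmode_vac : forall a w, tmode (vac V) a w = if a == -1 then w else 0;
  tmode_jacobi : forall (r : nat) u v (a : C), (r < T)%N -> sector T tau r u ->
    jacobi (rT r T)
      (coset (rT r T) (tmode u)) (coset (rT r T) (tmode u))
      (coset a (tmode v))
      (fun q => coset (rT r T + a) (tmode (vmode u q v)))
}.

Lemma expiD (x y : R) : expi (x + y) = expi x * expi y.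
Proof. by rewrite /expi cosD sinD; simpc; rewrite [sin x * _ + _]addrC. Qed.

Lemma expi0 : expi (0 : R) = 1.
Proof. by rewrite /expi cos0 sin0. Qed.

Lemma expiN2pi (n : nat) : expi (- (2 * pi * n%:R)) = 1.
Proof.
rewrite /expi cosN sinN mulr_natl [pi *+ 2 * _]mulr_natr -[_ *+ n]add0r.
by rewrite (periodicn (@cosD2pi R)) (periodicn (@sinD2pi R)) cos0 sin0 oppr0.
Qed.

Lemma expi2pi (n : int) : expi (2 * pi * n%:~R) = 1.
Proof.
case: (intP n) => [|m|m]; first by rewrite mulr0 expi0.
  have := expiD (2 * pi * m.+1%:R) (- (2 * pi * m.+1%:R)).
  by rewrite subrr expiN2pi mulr1 expi0.
by rewrite mulrNz mulrN -pmulrn expiN2pi.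
Qed.

Lemma linfun0 (U W : lmodType C) (f : U -> W) : linear f -> f 0 = 0.
Proof. by move=> fL; have := fL (-1) 0 0; rewrite !scaler0 addr0 scaleN1r addNr. Qed.

Lemma linfunD (U W : lmodType C) (f : U -> W) : linear f ->
  {morph f : x y / x + y}.
Proof. by move=> fL x y; have := fL 1 x y; rewrite !scale1r. Qed.

Lemma linfunZ (U W : lmodType C) (f : U -> W) a : linear f ->
  {morph f : x / a *: x}.
Proof. by move=> fL x; have := fL a x 0; rewrite (linfun0 fL) !addr0. Qed.

Lemma linfun_sum (U W : lmodType C) (f : U -> W) n (F : 'I_n -> U) : linear f ->
  f (\sum_i F i) = \sum_i f (F i).
Proof. by move=> fL; apply: big_morph; [exact: linfunD | exact: linfun0]. Qed.

Lemma sector_projP (V : voa) (T : nat) (tau : periodic_aut V T) (r : nat) v :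
  sector T tau r (sector_proj T tau r v).
Proof.
have tauL := aut_linear tau; have T0 : T%:R != 0 :> R.
  by rewrite pnatr_eq0 -lt0n (period_gt0 tau).
rewrite /sector /sector_proj (linfunZ _ tauL) (linfun_sum _ tauL).
rewrite [RHS]scalerA [expi _ * _]mulrC -[RHS]scalerA; congr (_ *: _).
pose h s := expi (- (2 * pi * (r * s)%:R / T%:R)) *: iter s tau v.
have hS s : tau (h s) = expi (2 * pi * (r%:Z)%:~R / T%:R) *: h s.+1.
  rewrite /h (linfunZ _ tauL) scalerA -expiD /=; congr (expi _ *: _).
  by move: (2 * pi) => c; rewrite mulnS natrD mulrDr mulrDl opprD addrA subrr add0r.
have hT : h T = h 0%N.
  rewrite /h (aut_period tau) muln0 /= mulr0 mul0r; congr (_ *: _).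
  by rewrite natrM mulrA mulfK // expiN2pi oppr0 expi0.
under eq_bigr do rewrite -/(h _) hS.
rewrite -!scaler_sumr; congr (_ *: _).
have : \sum_(i < T.+1) h i = \sum_(i < T.+1) h i by [].
by rewrite {1}big_ord_recl big_ord_recr /= hT addrC => E; apply: (addrI (h 0%N)).
Qed.

Lemma sector_modz (V : voa) (T : nat) (tau : V -> V) (r : int) v : (0 < T)%N ->
  sector T tau r v -> exists (s : nat) (q : int),
  [/\ (s < T)%N, sector T tau s v & rT r T = rT s T + q%:~R].
Proof.
move=> T0; have TZ : T%:Z != 0 by rewrite eqz_nat -lt0n.
have TR (F : numFieldType) : T%:R != 0 :> F by rewrite pnatr_eq0 -lt0n.
have [s Es] : exists s : nat, (r %% T%:Z)%Z = s%:Z.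
  by exists (absz (r %% T%:Z)%Z); rewrite gez0_abs // modz_ge0.
have rE : r = (r %/ T%:Z)%Z * T%:Z + s%:Z by rewrite -Es -divz_eq.
have sT : (s < T)%N by rewrite -ltz_nat -Es ltz_pmod // ltz_nat.
move: (r %/ T%:Z)%Z rE => q rE rv; exists s, q; split=> //.
  rewrite /sector rv rE rmorphD rmorphM /= -!pmulrn; congr (_ *: _).
  have -> : 2 * pi * (q%:~R * T%:R + s%:R) / T%:R
    = 2 * pi * q%:~R + 2 * pi * s%:R / T%:R :> R.
    by move: (2 * pi) => c; rewrite mulrDr mulrDl mulrA mulfK // TR.
  by rewrite expiD expi2pi mul1r.
by rewrite /rT rE rmorphD rmorphM /= -!pmulrn mulrDl mulfK ?TR // addrC.
Qed.

Lemma id_linear (V : lmodType C) : linear (@id V).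
Proof. by []. Qed.

Definition id_aut (V : voa) : periodic_aut V 1 :=
  @PeriodicAut V 1 id (@id_linear V) (inv_bij (fun=> erefl))
    (fun _ _ _ => erefl) erefl erefl isT (fun=> erefl).

Definition weak_module (V : voa) := twisted_module (id_aut V).

End Structures.

Lemma tmode_truncz (R : realType) (V : voa R) (T : nat) (tau : periodic_aut V T)
    (M : twisted_module tau) (r : int) u (w : M) : sector T tau r u ->
  eventually0 (coset (rT R r T) (fun a => tmode u a w)).
Proof.
move=> /(sector_modz (period_gt0 tau)) [s [q [sT us ->]]].
have [N uN] := tmode_trunc w sT us; exists (N - q) => n Nn.
by rewrite /coset -addrA -rmorphD; apply: uN; rewrite addrC -lerBlDr.
Qed.

Arguments vmode {R v} : rename.
Arguments tmode {R V T tau t} : rename.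
Arguments conf {R V} : rename.

Section Intertwining.
Variables (R : realType) (V : voa R) (T : nat) (tau : periodic_aut V T).
Local Notation C := R[i].

Section Spaces.
Variables M2 M3 : twisted_module tau.

(* (Hom(M2,M3)){x}, without the linearity of the coefficients *)
Definition series := C -> M2 -> M3.
HB.instance Definition _ := GRing.Lmodule.on series.

(* L(-1) = omega_0 *)
Definition is_generalized_intertwining (phi : series) : Prop :=
  [/\ forall a, linear (phi a),
      forall a w, eventually0 (coset a (fun b => phi b w)),
      forall a w, tmode conf 0 (phi a w) - phi a (tmode conf 0 w)
                    = - (a *: phi (a - 1) w)
    & forall v : V, exists k : nat, forall (a b : C) w,
        \sum_(i < k.+1) ((-1) ^+ i * 'C(k, i)%:R)
            *: tmode v (a + k%:R - i%:R) (phi (b + i%:R) w)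
      = \sum_(i < k.+1) ((-1) ^+ i * 'C(k, i)%:R)
            *: phi (b + i%:R) (tmode v (a + k%:R - i%:R) w)].

(* coefficient of x^(-b-1) in Res_x1 x1^rho (x1-x)^N Y_M3(u,x1) phi(x) *)
Definition res_left (rho : C) (u : V) (N : int) (phi : series) : series :=
  fun b w => \sum_(i \in [set: nat]) ((-1) ^+ i * binc N%:~R i)
     *: tmode u (rho + N%:~R - i%:R) (phi (b + i%:R) w).

(* coefficient of x^(-b-1) in Res_x1 x1^rho (-x+x1)^N phi(x) Y_M2(u,x1) *)
Definition res_right (rho : C) (u : V) (N : int) (phi : series) : series :=
  fun b w => \sum_(i \in [set: nat]) ((-1) ^ (N - i%:Z) * binc N%:~R i)
     *: phi (b + N%:~R - i%:R) (tmode u (rho + i%:R) w).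

(* u_n^H phi(x) for u in V^r, where rho = r/T.  Only the differences, not the
   two products separately, vanish for j large. *)
Definition sector_Hmode (rho : C) (u : V) (n : int) (phi : series) : series :=
  fun b w => \sum_(j \in [set: nat]) binc (- rho) j
     *: (res_left rho u (n + j%:Z) phi (b - rho - j%:R) w
         - res_right rho u (n + j%:Z) phi (b - rho - j%:R) w).

(* linear extension to V = V^0 + ... + V^(T-1) *)
Definition Hmode (u : V) (n : int) (phi : series) : series :=
  \sum_(r < T) sector_Hmode (rT R r T) (sector_proj T tau r u) n phi.

Lemma res_left_lin (rho : C) (u : V) N (a : C) (phi psi : series) b w :
  (forall c u, linear (tmode u c : M3 -> M3)) ->
  is_generalized_intertwining phi -> is_generalized_intertwining psi ->
  res_left rho u N (a *: phi + psi) b w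
    = a *: res_left rho u N phi b w + res_left rho u N psi b w.
Proof.
move=> tL [_ p0 _ _] [_ q0 _ _].
have fin (chi : series) : (forall a w, eventually0 (coset a (fun b => chi b w))) ->
    fin0 (fun i : nat => ((-1) ^+ i * binc N%:~R i)
       *: tmode u (rho + N%:~R - i%:R) (chi (b + i%:R) w)).
  move=> c0; have [P cP] := eventually0_ge (c0 b w) 0; exists P => i Pi.
  have := cP i Pi; rewrite /coset add0r => ->.
  by rewrite (linfun0 (tL _ _)) scaler0.
rewrite /res_left -fsum_lin; [|exact: fin|exact: fin].
apply: eq_fsbigr => i _.
by rewrite tL scalerDr !scalerA mulrC.
Qed.

Lemma res_right_lin (r : nat) (u : V) N (a : C) (phi psi : series) b w :
  (r < T)%N -> sector T tau r u ->
  is_generalized_intertwining phi -> is_generalized_intertwining psi ->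
  res_right (rT R r T) u N (a *: phi + psi) b w
    = a *: res_right (rT R r T) u N phi b w + res_right (rT R r T) u N psi b w.
Proof.
move=> rT ur [pL _ _ _] [qL _ _ _].
have [P uP] := eventually0_ge (tmode_trunc w rT ur) 0.
have fin (chi : series) : (forall c, linear (chi c)) ->
    fin0 (fun i : nat => ((-1) ^ (N - i%:Z) * binc N%:~R i)
       *: chi (b + N%:~R - i%:R) (tmode u (Defs.rT R r T + i%:R) w)).
  move=> cL; exists P => i Pi; have := uP i Pi; rewrite /coset add0r => ->.
  by rewrite (linfun0 (cL _)) scaler0.
rewrite /res_right -fsum_lin; [|exact: fin|exact: fin].
apply: eq_fsbigr => i _.
by rewrite scalerDr !scalerA mulrC.
Qed.

Definition wcomm (v : V) (phi : series) (k : nat) (a b : C) (w : M2) : M3 :=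
  \sum_(i < k.+1) ((-1) ^+ i * 'C(k, i)%:R)
     *: (tmode v (a + k%:R - i%:R) (phi (b + i%:R) w)
         - phi (b + i%:R) (tmode v (a + k%:R - i%:R) w)).

Lemma wcommE v phi k : (forall a b w, wcomm v phi k a b w = 0) <->
  forall (a b : C) w,
        \sum_(i < k.+1) ((-1) ^+ i * 'C(k, i)%:R)
            *: tmode v (a + k%:R - i%:R) (phi (b + i%:R) w)
      = \sum_(i < k.+1) ((-1) ^+ i * 'C(k, i)%:R)
            *: phi (b + i%:R) (tmode v (a + k%:R - i%:R) w).
Proof.
have E a b w : wcomm v phi k a b w = 
        \sum_(i < k.+1) ((-1) ^+ i * 'C(k, i)%:R)
            *: tmode v (a + k%:R - i%:R) (phi (b + i%:R) w)
      - \sum_(i < k.+1) ((-1) ^+ i * 'C(k, i)%:R)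
            *: phi (b + i%:R) (tmode v (a + k%:R - i%:R) w).
  by rewrite -sumrB; apply: eq_bigr => i _; rewrite scalerBr.
by split=> H a b w; have := H a b w; rewrite E;
  [move/eqP; rewrite subr_eq0 => /eqP | move=> ->; rewrite subrr].
Qed.

Lemma wcommS v phi k a b w :
  wcomm v phi k.+1 a b w = wcomm v phi k (a + 1) b w - wcomm v phi k a (b + 1) w.
Proof.
rewrite /wcomm; set D := fun a b => tmode v a (phi b w) - phi b (tmode v a w).
pose G i := D (a + k.+1%:R - i%:R) (b + i%:R).
transitivity (\sum_(i < k.+2) ((-1) ^+ i * 'C(k.+1, i)%:R) *: G i); first by [].
have -> : \sum_(i < k.+1) ((-1) ^+ i * 'C(k, i)%:R)
     *: (tmode v (a + 1 + k%:R - i%:R) (phi (b + i%:R) w)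
         - phi (b + i%:R) (tmode v (a + 1 + k%:R - i%:R) w))
   = \sum_(i < k.+1) ((-1) ^+ i * 'C(k, i)%:R) *: G i.
  by apply: eq_bigr => i _; rewrite /G /D -(nat1r k) addrA.
have -> : \sum_(i < k.+1) ((-1) ^+ i * 'C(k, i)%:R)
     *: (tmode v (a + k%:R - i%:R) (phi (b + 1 + i%:R) w)
         - phi (b + 1 + i%:R) (tmode v (a + k%:R - i%:R) w))
   = \sum_(i < k.+1) ((-1) ^+ i * 'C(k, i)%:R) *: G i.+1.
  apply: eq_bigr => i _; rewrite /G /D -(nat1r k) -(nat1r i).
  have -> : a + (1 + k%:R) - (1 + i%:R) = a + k%:R - i%:R :> C by ring.
  by rewrite addrA.
rewrite big_ord_recl [X in _ = X - _]big_ord_recl /= !bin0 -addrA; congr (_ + _).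
under eq_bigr => i _ do rewrite /bump /= add1n binS natrD mulrDr scalerDl.
rewrite big_split /=; congr (_ + _).
  by rewrite big_ord_recr /= bin_small // mulr0 scale0r addr0.
by rewrite -sumrN; apply: eq_bigr => i _; rewrite exprS mulN1r mulNr scaleNr.
Qed.

Lemma wcomm_ge v phi k k' : (k <= k')%N ->
  (forall a b w, wcomm v phi k a b w = 0) ->
  forall a b w, wcomm v phi k' a b w = 0.
Proof.
move=> /subnKC <- H; elim: (k' - k)%N => [|n IHn] a b w; first by rewrite addn0.
by rewrite addnS wcommS !IHn subrr.
Qed.

Lemma res_eq (rho : C) u phi : is_generalized_intertwining phi ->
  exists k : nat, forall N : nat, (k <= N)%N -> forall b w,
  res_left rho u N%:Z phi b w = res_right rho u N%:Z phi b w.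
Proof.
move=> [_ _ _ /(_ u) [k /wcommE kP]]; exists k => N kN b w.
have /wcommE/(_ rho b w) := wcomm_ge kN kP; rewrite /res_left /res_right.
have big i : (N.+1 <= i)%N -> binc (N%:Z)%:~R i = 0 :> C.
  by move=> Ni; rewrite -pmulrn binc_nat bin_small.
rewrite !(@fsum_trunc _ _ N.+1); last 2 first.
- by move=> i /big ->; rewrite mulr0 scale0r.
- by move=> i /big ->; rewrite mulr0 scale0r.
rewrite -!pmulrn => E; under eq_bigr do rewrite binc_nat; rewrite {}E.
rewrite (reindex_inj rev_ord_inj) /=; apply: eq_bigr => i _.
have iN : (i <= N)%N by rewrite -ltnS.
rewrite subSS binc_nat bin_sub // subzn // -exprnP natrB // opprB.
by rewrite !addrA; congr (_ *: phi _ (tmode u _ w)); rewrite addrAC addrK.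
Qed.

Lemma res_fin0 (rho : C) u (n : int) phi (b : C) w : is_generalized_intertwining phi ->
  fin0 (fun j : nat => binc (- rho) j
     *: (res_left rho u (n + j%:Z) phi (b - rho - j%:R) w
         - res_right rho u (n + j%:Z) phi (b - rho - j%:R) w)).
Proof.
move=> /(res_eq rho u) [k kP]; exists (k + absz n)%N => j kj.
suff [N -> kN] : exists2 N : nat, n + j%:Z = N%:Z & (k <= N)%N.
  by rewrite kP // subrr scaler0.
by exists (absz (n + j%:Z)); lia.
Qed.

Lemma sector_Hmode_lin (r : nat) u n (a : C) (phi psi : series) :
  (r < T)%N -> sector T tau r u ->
  is_generalized_intertwining phi -> is_generalized_intertwining psi ->
  sector_Hmode (rT R r T) u n (a *: phi + psi)
    = a *: sector_Hmode (rT R r T) u n phi + sector_Hmode (rT R r T) u n psi.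
Proof.
move=> rT ur pP qP; apply/funext => b; apply/funext => w.
transitivity (a *: sector_Hmode (Defs.rT R r T) u n phi b w
                + sector_Hmode (Defs.rT R r T) u n psi b w); last by [].
rewrite /sector_Hmode -fsum_lin; [|exact: res_fin0|exact: res_fin0].
apply: eq_fsbigr => j _.
rewrite res_left_lin // ?res_right_lin //; last by move=> *; exact: tmode_linearr.
by rewrite opprD addrACA -scalerBr scalerDr !scalerA mulrC.
Qed.

Lemma Hmode_lin u n (a : C) (phi psi : series) :
  is_generalized_intertwining phi -> is_generalized_intertwining psi ->
  Hmode u n (a *: phi + psi) = a *: Hmode u n phi + Hmode u n psi.
Proof.
move=> pP qP; rewrite /Hmode scaler_sumr -big_split /=; apply: eq_bigr => r _.
by apply: sector_Hmode_lin => //; exact: sector_projP.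
Qed.

Lemma Hmode0 u n : Hmode u n 0 = 0.
Proof.
have z (W : nmodType) (F : nat -> W) : F =1 (fun=> 0) ->
    \sum_(i \in [set: nat]) F i = 0.
  by move=> F0; rewrite fsbig1.
rewrite /Hmode big1 // => r _; apply/funext => b; apply/funext => w.
apply: (z _) => j; rewrite /res_left /res_right !z ?subrr ?scaler0 // => i.
- by rewrite /= scaler0.
- by rewrite (linfun0 (tmode_linearr _ _)) scaler0.
Qed.

Definition generalized_intertwining : {pred series} :=
  fun phi => `[< is_generalized_intertwining phi >].

Lemma generalized_intertwiningP phi :
  reflect (is_generalized_intertwining phi) (phi \in generalized_intertwining).
Proof. exact: asboolP. Qed.

Lemma generalized_intertwining_submod : submod_closed generalized_intertwining.
Proof.
split.
  apply/generalized_intertwiningP; split.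
  - by move=> a c x y; rewrite /= scaler0 addr0.
  - by move=> a w; exists 0.
  - by move=> a w; rewrite [X in X - _](linfun0 (tmode_linearr _ _)) sub0r scaler0.
  - move=> v; exists 0%N => a b w.
    by rewrite !big1 // => i _; rewrite ?(linfun0 (tmode_linearr _ _)) scaler0.
move=> a phi psi /generalized_intertwiningP [pL p0 pD pC].
move=> /generalized_intertwiningP [qL q0 qD qC].
apply/generalized_intertwiningP; split.
- move=> b c x y.
  transitivity (a *: phi b (c *: x + y) + psi b (c *: x + y)); first by [].
  rewrite pL qL.
  transitivity (c *: (a *: phi b x + psi b x) + (a *: phi b y + psi b y)) => //.
  by rewrite !scalerDr !scalerA mulrC addrACA.
- by move=> b w; apply: (eventually0_lin a (p0 b w) (q0 b w)).
- move=> b w.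
  transitivity (a *: (tmode conf 0 (phi b w) - phi b (tmode conf 0 w))
                + (tmode conf 0 (psi b w) - psi b (tmode conf 0 w))).
    by rewrite [X in X - _]tmode_linearr opprD addrACA scalerBr.
  by rewrite pD qD scalerN -opprD scalerA mulrC -scalerA -scalerDr.
- move=> v; have [k /wcommE kP] := pC v; have [l /wcommE lP] := qC v.
  exists (maxn k l); apply/wcommE => b c w.
  have := wcomm_ge (leq_maxl k l) kP b c w.
  have := wcomm_ge (leq_maxr k l) lP b c w.
  move: (maxn k l) => m q00 p00.
  transitivity (a *: wcomm v phi m b c w + wcomm v psi m b c w); last first.
    by rewrite p00 q00 scaler0 addr0.
  rewrite /wcomm scaler_sumr -big_split /=; apply: eq_bigr => i _.
  rewrite [X in _ *: (X - _)]tmode_linearr opprD addrACA -scalerBr scalerDr.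
  by rewrite !scalerA mulrC.
Qed.

HB.instance Definition _ :=
  GRing.isSubmodClosed.Build C series generalized_intertwining
    generalized_intertwining_submod.

(* H(M2,M3) *)
Record Hspace := HSpace {
  Hspace_val :> series;
  _ : Hspace_val \in generalized_intertwining
}.

HB.instance Definition _ := [isSub for Hspace_val].
HB.instance Definition _ := [Choice of Hspace by <:].
HB.instance Definition _ := [SubChoice_isSubLmodule of Hspace by <:].

Section WithM.
Variable M : weak_module V.

(* The truncation condition "w_(c+q) x = 0 for q rational sufficiently large"
   is taken with a bound which may depend on the denominator of q.  A single
   bound for all rational q would be a uniformity over infinitely many cosets
   of Z that is not imposed on generalized intertwining operators, and a
   homomorphism from M to H(M2,M3) need not have it. *)
Definition is_intertwining (I : M -> series) : Prop :=
  [/\ forall a x, linear (fun w => I w a x),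
      forall w a, linear (I w a),
      forall w x (c : C) (d : nat), (0 < d)%N -> exists N : rat,
        forall q : rat, N <= q -> d%:R * q \is a Num.int ->
          I w (c + ratr q) x = 0,
      forall w a x, I (tmode conf 0 w) a x = - (a *: I w (a - 1) x)
    & forall (r : int) (u : V), sector T tau r u -> forall w (a : C),
        jacobi (rT R r T)
          (coset (rT R r T) (tmode u)) (coset (rT R r T) (tmode u))
          (coset a (I w))
          (fun q => coset (rT R r T + a) (I (tmode u q%:~R w)))].

Definition intertwining : {pred M -> series} := fun I => `[< is_intertwining I >].

Lemma intertwiningP I : reflect (is_intertwining I) (I \in intertwining).
Proof. exact: asboolP. Qed.

Lemma intertwining_eventually0 I : is_intertwining I ->
  forall w (a : C) x, eventually0 (coset a (fun b => I w b x)).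
Proof.
move=> [_ _ IT _ _] w a x; have [N IN] := IT w x a 1%N isT.
exists (Num.ceil N) => n Nn; rewrite /coset -(ratr_int _ n); apply: IN.
  by rewrite (le_trans (ceil_ge N)) // ler_int.
by rewrite mul1r intr_int.
Qed.

Lemma tmode_weak_eventually0 u (w : M) :
  exists N : int, forall q : int, N <= q -> tmode u q%:~R w = 0.
Proof.
have u0 : sector 1 (id_aut V) 0%N u.
  by rewrite /sector mulr0 mul0r expi0 scale1r.
have [N uN] := tmode_trunc w (ltnSn 0) u0; exists N => q Nq.
by rewrite -[RHS](uN q Nq) /coset /rT mul0r add0r.
Qed.

Lemma intertwining_submod : submod_closed intertwining.
Proof.
split.
  apply/intertwiningP; split.
  - by move=> a x c w w'; rewrite /= scaler0 addr0.
  - by move=> w a c x y; rewrite /= scaler0 addr0.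
  - by move=> w x c d _; exists 0.
  - by move=> w a x; rewrite [in RHS]scaler0 oppr0.
  - move=> r u _ w a n m k x.
    have z (W : nmodType) (F : nat -> W) : F =1 (fun=> 0) ->
      \sum_(i \in [set: nat]) F i = 0 by move=> F0; rewrite fsbig1.
    rewrite !z ?subrr // => i; rewrite ?scaler0 //.
    by rewrite [X in _ *: X](linfun0 (tmode_linearr _ _)) scaler0.
move=> c I J /intertwiningP Ii /intertwiningP Ji; apply/intertwiningP.
have I0 := intertwining_eventually0 Ii; have J0 := intertwining_eventually0 Ji.
case: Ii Ji => [IM IL IT ID IJ] [JM JL JT JD JJ]; split.
- move=> a x b w w'.
  transitivity (c *: I (b *: w + w') a x + J (b *: w + w') a x); first by [].
  rewrite IM JM.
  transitivity (b *: (c *: I w a x + J w a x) + (c *: I w' a x + J w' a x)) => //.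
  by rewrite !scalerDr !scalerA mulrC addrACA.
- move=> w a b x y.
  transitivity (c *: I w a (b *: x + y) + J w a (b *: x + y)); first by [].
  rewrite IL JL.
  transitivity (b *: (c *: I w a x + J w a x) + (c *: I w a y + J w a y)) => //.
  by rewrite !scalerDr !scalerA mulrC addrACA.
- move=> w x a d d0; have [N IN] := IT w x a d d0; have [P JP] := JT w x a d d0.
  exists (Num.max N P) => q; rewrite ge_max => /andP[Nq Pq] qZ.
  transitivity (c *: I w (a + ratr q) x + J w (a + ratr q) x); first by [].
  by rewrite IN // JP // scaler0 addr0.
- move=> w a x.
  transitivity (c *: I (tmode conf 0 w) a x + J (tmode conf 0 w) a x); first by [].
  rewrite ID JD.
  transitivity (- (a *: (c *: I w (a - 1) x + J w (a - 1) x))) => //.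
  by rewrite scalerDr scalerN !scalerA mulrC opprD.
- move=> r u ur w a.
  have W0 (K : M -> series) : (forall b x, linear (fun w => K w b x)) ->
      exists N : int, forall q, N <= q -> forall (l : int) x,
      coset (rT R r T + a) (K (tmode u q%:~R w)) l x = 0.
    move=> KL; have [N uN] := tmode_weak_eventually0 u w; exists N => q Nq l x.
    by rewrite /coset uN //; exact: (linfun0 (KL _ x)).
  apply: (jacobi_lin c _ _ _ _ _ _ (W0 I IM) (W0 J JM) (IJ r u ur w a) (JJ r u ur w a)).
  - by move=> m; exact: tmode_linearr.
  - by move=> k; exact: IL.
  - by move=> k; exact: JL.
  - by move=> x; exact: I0.
  - by move=> x; exact: J0.
  - by move=> x; exact: tmode_truncz.
Qed.

HB.instance Definition _ :=
  GRing.isSubmodClosed.Build C (M -> series) intertwining intertwining_submod.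

(* I_V(M3; M M2) *)
Record Intertwiner := IntertwinerV {
  Intertwiner_val :> M -> series;
  _ : Intertwiner_val \in intertwining
}.

HB.instance Definition _ := [isSub for Intertwiner_val].
HB.instance Definition _ := [Choice of Intertwiner by <:].
HB.instance Definition _ := [SubChoice_isSubLmodule of Intertwiner by <:].

(* f intertwines the actions of u_n on M and u_n^H on H(M2,M3); the equation
   is stated in the space of all series, where u_n^H is defined. *)
Definition is_hom (f : M -> Hspace) : Prop :=
  linear f /\
  forall (u : V) (n : int) w, f (tmode u n%:~R w) = Hmode u n (f w) :> series.

Definition hom : {pred M -> Hspace} := fun f => `[< is_hom f >].

Lemma homP f : reflect (is_hom f) (f \in hom).
Proof. exact: asboolP. Qed.

Lemma hom_submod : submod_closed hom.
Proof.
split.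
  apply/homP; split=> [a x y|u n w]; first by rewrite /= scaler0 addr0.
  by rewrite [RHS]Hmode0.
move=> a f g /homP [fL fH] /homP [gL gH]; apply/homP; split.
  move=> b x y; transitivity (a *: f (b *: x + y) + g (b *: x + y)); first by [].
  rewrite fL gL.
  transitivity (b *: (a *: f x + g x) + (a *: f y + g y)) => //.
  by rewrite !scalerDr !scalerA mulrC addrACA.
move=> u n w; transitivity (a *: (f (tmode u n%:~R w) : series)
   + (g (tmode u n%:~R w) : series)); first by [].
by rewrite fH gH -Hmode_lin //; apply/generalized_intertwiningP; exact: (valP (_ : Hspace)).
Qed.

HB.instance Definition _ :=
  GRing.isSubmodClosed.Build C (M -> Hspace) hom hom_submod.

(* Hom_V(M, H(M2,M3)) *)
Record HomV := MkHomV {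
  HomV_val :> M -> Hspace;
  _ : HomV_val \in hom
}.

HB.instance Definition _ := [isSub for HomV_val].
HB.instance Definition _ := [Choice of HomV by <:].
HB.instance Definition _ := [SubChoice_isSubLmodule of HomV by <:].

End WithM.
End Spaces.
End Intertwining.

(* Main.v *)
Require Import Defs.
From HB Require Import structures.
From mathcomp Require Import all_boot all_order all_algebra.
From mathcomp Require Import zify ring complex.
From mathcomp Require Import boolp classical_sets fsbigop reals trigo.

Set Implicit Arguments.
Unset Strict Implicit.
Unset Printing Implicit Defensive.

Import Order.TTheory GRing.Theory Num.Theory.

Local Open Scope ring_scope.
Local Open Scope complex_scope.
Local Open Scope classical_set_scope.

(* Fix phi(x) from M2 to M3 and u in V^r, rho = r/T.  For m = 0 (the
   coefficient of x1^(-rho-1)) the twisted Jacobi identity reads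
     Res_x1 x1^rho [u(x1), phi(x)]_n = sum_i binom(rho, i) x^(rho-i) psi_(n+i)
   where [ , ]_n carries the weights (x1-x)^n and (-x+x1)^n, phi = I(w, x) and
   psi_n = I(u_n w, x); that is, up to the factor x^rho, the residues are
   (1+E)^rho psi for a locally nilpotent shift E.  The definition of u_n^H phi
   is (1+E)^(-rho) applied to the residues, so psi_n = u_n^H phi is equivalent
   to the case m = 0.  Both sides of the Jacobi identity satisfy the recurrence
   D(n+1,m,k) = D(n,m+1,k) - D(n,m,k+1) and vanish for n large (weak
   commutativity and truncation), so the case m = 0 gives all m. *)

(** * Generalized binomial coefficients *)

Section Binomials.
Variable R : realType.
Local Notation C := R[i].

Lemma binc0 (x : C) : binc x 0 = 1.
Proof. by rewrite /binc big_ord0 divr1. Qed.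

Lemma mul_bincS (x : C) i : i.+1%:R * binc x i.+1 = (x - i%:R) * binc x i.
Proof.
have i0 : i.+1%:R != 0 :> C by rewrite pnatr_eq0.
have f0 : i`!%:R != 0 :> C by rewrite pnatr_eq0 -lt0n fact_gt0.
by rewrite /binc big_ord_recr /= factS natrM; field; rewrite f0 nat1r.
Qed.

Lemma bincS (x : C) i : binc (x + 1) i.+1 = binc x i.+1 + binc x i.
Proof.
elim: i => [|i IHi].
  have := mul_bincS (x + 1) 0; have := mul_bincS x 0.
  by rewrite !mul1r !binc0 !subr0 !mulr1 => -> ->.
have i0 : i.+2%:R != 0 :> C by rewrite pnatr_eq0.
apply: (mulfI i0); rewrite mul_bincS IHi [RHS]mulrDr mul_bincS.
have E := mul_bincS x i; rewrite -!natr1 in E *.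
have -> : x + 1 - (i%:R + 1) = x - i%:R by ring.
by rewrite mulrDr -E; ring.
Qed.

Lemma binc0S i : binc (0 : C) i.+1 = 0.
Proof. by rewrite /binc big_ord_recl /= subrr !mul0r. Qed.

(** Vandermonde's identity by induction: s+1 splits as i + (s+1-i), [mul_bincS] absorbs each part,
    and (x-i) + (y-(s-i)) = x+y-s. *)
Lemma binc_conv (x y : C) s :
  \sum_(i < s.+1) binc x i * binc y (s - i) = binc (x + y) s.
Proof.
elim: s => [|s IHs]; first by rewrite big_ord1 !binc0 mulr1.
have s0 : s.+1%:R != 0 :> C by rewrite pnatr_eq0.
apply: (mulfI s0); rewrite mul_bincS -IHs !mulr_sumr.
have E (i : 'I_s.+2) : s.+1%:R * (binc x i * binc y (s.+1 - i))
   = i%:R * binc x i * binc y (s.+1 - i)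
     + binc x i * ((s.+1 - i)%:R * binc y (s.+1 - i)).
  by rewrite natrB ?leq_ord //; ring.
rewrite (eq_bigr _ (fun i _ => E i)) big_split /=.
rewrite big_ord_recl [X in _ + X]big_ord_recr /= subnn !mul0r mulr0 add0r addr0.
rewrite -big_split /=; apply: eq_bigr => i _.
rewrite /bump /= add1n subSS mul_bincS subSn ?leq_ord // mul_bincS.
by rewrite natrB ?leq_ord //; ring.
Qed.

(** Reversing the factors and changing their signs. This brings the coefficients on the right of
    [jacobi] to the form binom(rho + m, i). *)
Lemma binc_opp (x : C) i : (-1) ^+ i * binc (i%:R - x - 1) i = binc x i.
Proof.
rewrite /binc mulrA; congr (_ / _).
rewrite -[X in (-1) ^+ X]card_ord -prodrN (reindex_inj rev_ord_inj) /=.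
by apply: eq_bigr => j _; rewrite natrB //= -natr1; ring.
Qed.

End Binomials.

(** * Finitely supported sums *)

Section FiniteSums.
Variables (K : pzRingType) (W : lmodType K).

Lemma fin0_scale (c : nat -> K) (F : nat -> W) :
  fin0 F -> fin0 (fun i => c i *: F i).
Proof. by move=> [N FN]; exists N => i /FN ->; rewrite scaler0. Qed.

Lemma fin0_shift (F : nat -> W) : fin0 F -> fin0 (fun i => F i.+1).
Proof. by move=> [N FN]; exists N => i Ni; apply/FN/ltnW. Qed.

Lemma fsumD (F G : nat -> W) : fin0 F -> fin0 G ->
  \sum_(i \in [set: nat]) (F i + G i)
    = \sum_(i \in [set: nat]) F i + \sum_(i \in [set: nat]) G i.
Proof.
move=> F0 G0; rewrite -[\sum_(i \in _) F i]scale1r -(fsum_lin 1 F0 G0).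
by apply: eq_fsbigr => i _; rewrite scale1r.
Qed.

Lemma fsumN (F : nat -> W) : fin0 F ->
  \sum_(i \in [set: nat]) - F i = - \sum_(i \in [set: nat]) F i.
Proof.
move=> [N FN]; rewrite (fsum_trunc FN) (@fsum_trunc _ (fun i => - F i) N) ?sumrN // => i Ni.
by rewrite FN ?oppr0.
Qed.

Lemma fsum_recl (F : nat -> W) : fin0 F ->
  \sum_(i \in [set: nat]) F i = F 0%N + \sum_(i \in [set: nat]) F i.+1.
Proof.
move=> [N FN]; rewrite (@fsum_trunc _ F N.+1) ?(@fsum_trunc _ (F \o S) N).
- by rewrite big_ord_recl.
- by move=> i Ni; apply/FN/ltnW.
- by move=> i Ni; apply/FN/ltnW.
Qed.

End FiniteSums.

(** * Complex powers of 1 + E for a shift E *)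

Section BinomialSums.
Variables (R : realType).
Local Notation C := R[i].
Variable W : lmodType C.

Lemma fsum_binc0 (F : nat -> W) : fin0 F ->
  \sum_(i \in [set: nat]) binc 0 i *: F i = F 0%N.
Proof.
move=> F0; rewrite fsum_recl; last exact: fin0_scale.
rewrite binc0 scale1r (@fsum_trunc _ _ 0) ?big_ord0 ?addr0 // => i _.
by rewrite binc0S scale0r.
Qed.

Lemma fsum_bincD1 (x : C) (F : nat -> W) : fin0 F ->
  \sum_(i \in [set: nat]) binc (x + 1) i *: F i
    = \sum_(i \in [set: nat]) binc x i *: F i
      + \sum_(i \in [set: nat]) binc x i *: F i.+1.
Proof.
move=> F0; rewrite fsum_recl; last exact: fin0_scale.
rewrite [X in _ = X + _]fsum_recl; last exact: fin0_scale.
have F1 := fin0_shift F0.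
rewrite !binc0 -addrA -fsumD; [|exact: fin0_scale..].
by congr (_ + _); apply: eq_fsbigr => i _; rewrite bincS scalerDl.
Qed.

(* (1 + E)^x, where (E f) n b = f (n+1) (b-1) *)
Definition shift_sum (x : C) (f : int -> C -> W) (n : int) (b : C) : W :=
  \sum_(i \in [set: nat]) binc x i *: f (n + i%:Z) (b - i%:R).

(** Makes E locally nilpotent on f, so that (1+E)^x f is a finite sum for any complex x. *)
Definition bounded_modes (f : int -> C -> W) : Prop :=
  exists N : int, forall n, N <= n -> forall b, f n b = 0.

Lemma bounded_modes_fin0 f (n : int) (b : C) :
  bounded_modes f -> fin0 (fun i => f (n + i%:Z) (b - i%:R)).
Proof.
move=> [N fN]; exists (absz (N - n)) => i Ni; apply: fN; lia.
Qed.

Lemma shift_sum0 f n b : bounded_modes f -> shift_sum 0 f n b = f n b.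
Proof.
move=> f0; rewrite /shift_sum fsum_binc0 ?addr0 ?subr0 //.
exact: bounded_modes_fin0.
Qed.

Lemma shift_sumD1 x f n b : bounded_modes f ->
  shift_sum (x + 1) f n b = shift_sum x f n b + shift_sum x f (n + 1) (b - 1).
Proof.
move=> f0; rewrite /shift_sum fsum_bincD1; last exact: bounded_modes_fin0.
congr (_ + _); apply: eq_fsbigr => i _; congr (_ *: f _ _); first lia.
by rewrite -nat1r opprD addrA.
Qed.

(** The exponent law for 1 + E. It makes (1+E)^rho and (1+E)^(-rho) mutually inverse. *)
Lemma shift_sum_comp x y f n b : bounded_modes f ->
  shift_sum x (shift_sum y f) n b = shift_sum (x + y) f n b.
Proof.
move=> [N fN]; set K := absz (N - n).
have f0 i c : (K <= i)%N -> f (n + i%:Z) c = 0 by move=> Ki; apply: fN; lia.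
rewrite {1}/shift_sum [RHS]/shift_sum !(@fsum_trunc _ _ K); last 2 first.
- by move=> i /f0 ->; rewrite scaler0.
- move=> i Ki; rewrite /shift_sum (@fsum_trunc _ _ 0) ?big_ord0 ?scaler0 // => j _.
  by rewrite fN ?scaler0 //; lia.
(* The double sum is reindexed by the total shift s = i + j; the inner sum over i is then
   Vandermonde's. *)
pose g i s := (binc x i * binc y (s - i)) *: f (n + s%:Z) (b - s%:R).
transitivity (\sum_(0 <= i < K) \sum_(0 <= s < K | (i <= s)%N) g i s).
  rewrite big_mkord; apply: eq_bigr => i _.
  rewrite big_mkcond /= (big_cat_nat (n := i)) //= ?(ltnW (ltn_ord i)) //.
  rewrite big1_seq ?add0r => [|s /=]; last first.
    by rewrite mem_index_iota => /andP[_ si]; rewrite leqNgt si.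
  rewrite /shift_sum (@fsum_trunc _ _ (K - i)); last first.
    by move=> j Kj; rewrite fN ?scaler0 //; lia.
  rewrite -[X in _ = \sum_(X <= _ < _ | _) _]add0n big_addn big_mkord scaler_sumr; apply: eq_bigr => j _.
  rewrite leq_addl /g addnK scalerA; congr (_ *: f _ _); first lia.
  by rewrite natrD; ring.
rewrite (exchange_big_dep_nat predT) //= big_mkord; apply: eq_bigr => s _.
rewrite -scaler_suml -binc_conv; congr (_ *: _).
rewrite -[RHS](big_mkord xpredT (fun i => binc x i * binc y (s - i))).
by rewrite (big_nat_widen _ _ K) //; exact: ltn_ord.
Qed.

End BinomialSums.

(** * Roots of unity and the decomposition of V into sectors *)

Section Sectors.
Variable R : realType.
Local Notation C := R[i].

Lemma expiX (x : R) n : expi x ^+ n = expi (n%:R * x).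
Proof.
elim: n => [|n IHn]; first by rewrite mul0r expi0.
by rewrite exprS IHn -expiD -(nat1r n) mulrDl mul1r.
Qed.

(** By the half-angle formula cos x = 1 would force sin(x/2) = 0, but x/2 lies strictly between 0
    and pi. *)
Lemma expi_neq1 (x : R) : 0 < x < 2 * pi -> expi x != 1.
Proof.
move=> /andP[x0 x2]; apply/eqP => x1.
have y0 : 0 < sin (x / 2).
  by rewrite sin_gt0_pi // divr_gt0 //= ltr_pdivrMr // mulrC.
have: cos x = 1 by have := congr1 (@complex.Re R) x1.
have {1}-> : x = x / 2 + x / 2 by rewrite -splitr.
rewrite cosD -!expr2 => E; have := cos2Dsin2 (x / 2); rewrite -[in RHS]E.
move=> /addrI /eqP; rewrite -subr_eq0 opprK -mulr2n mulrn_eq0 expf_eq0 /=.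
by rewrite gt_eqF.
Qed.

(** A geometric sum over the powers of a T-th root of unity other than 1. *)
Lemma sum_expi (T : nat) (d : int) : (0 < absz d < T)%N ->
  \sum_(t < T) expi (t%:R * (2 * pi * d%:~R / T%:R)) = 0 :> C.
Proof.
move=> /andP[d0 dT]; set x := 2 * pi * d%:~R / T%:R.
have T0 : T%:R != 0 :> R by rewrite pnatr_eq0; lia.
have x1 : expi x != 1.
  have y1 : expi (2 * pi * (absz d)%:R / T%:R) != 1 :> C.
    have p0 : 0 < 2 * pi :> R by rewrite mulr_gt0 ?pi_gt0.
    have d1 : 0 < (absz d)%:R :> R by rewrite ltr0n.
    have T1 : 0 < T%:R :> R by rewrite ltr0n; lia.
    apply: expi_neq1; apply/andP; split.
      by apply: divr_gt0 => //; exact: mulr_gt0.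
    by rewrite ltr_pdivrMr // ltr_pM2l // ltr_nat.
  (* For negative d the root is the inverse of the one for |d|. *)
  have [dE|dE] : d = absz d \/ d = - (absz d)%:Z by lia.
    by move: y1; rewrite [(absz d)%:R]pmulrn -dE.
  apply: contra_neq y1 => E; move: (expi0 R).
  rewrite -(addrN x) expiD E mul1r => <-; congr expi.
  by rewrite /x {2}dE mulrNz mulrN mulNr opprK.
have : (expi x - 1) * \sum_(t < T) expi x ^+ t = 0.
  rewrite -subrX1 expiX /x mulrC divfK // expi2pi subrr //.
move/eqP; rewrite mulf_eq0 subr_eq0 (negPf x1) /= => /eqP E.
by rewrite -[RHS]E; apply: eq_bigr => t _; rewrite expiX.
Qed.

Variables (V : voa R) (T : nat) (tau : periodic_aut V T).

(** Orthogonality of characters: after exchanging the sums only the term s = 0 survives, with weight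
    T. *)
Lemma sector_proj_sum v : \sum_(r < T) sector_proj T tau r v = v.
Proof.
have T0 := period_gt0 tau; have T1 : T%:R != 0 :> C by rewrite pnatr_eq0 -lt0n.
rewrite -scaler_sumr exchange_big /= (bigD1 (Ordinal T0)) //= -scaler_suml.
rewrite [X in _ + X]big1 => [|s s0]; last first.
  rewrite -scaler_suml -[X in _ = X](scale0r (iter s tau v)); congr (_ *: _).
  have s1 : (0 < absz (- s%:Z) < T)%N.
    by rewrite abszN /= ltn_ord andbT lt0n; apply: contra_neq s0 => s0; exact/val_inj.
  rewrite -[RHS](sum_expi s1); apply: eq_bigr => r _; congr expi.
  by rewrite natrM mulrNz -pmulrn; field; rewrite pnatr_eq0 -lt0n.
rewrite addr0 (eq_bigr (fun=> 1)) => [|r _]; last first.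
  by rewrite muln0 mulr0 mul0r oppr0 expi0.
by rewrite sumr_const card_ord scalerA mulVf // scale1r.
Qed.

Lemma sector_iter (s t : nat) v : sector T tau s v ->
  iter t tau v = expi (t%:R * (2 * pi * s%:R / T%:R)) *: v.
Proof.
move=> vs; elim: t => [|t IHt]; first by rewrite mul0r expi0 scale1r.
rewrite iterS IHt (linfunZ _ (aut_linear tau)) vs scalerA -expiD.
by rewrite -(nat1r t) [(1 + _) * _]mulrDl mul1r addrC -pmulrn.
Qed.

Lemma sector_proj_id (r s : nat) v : (r < T)%N -> (s < T)%N ->
  sector T tau s v -> sector_proj T tau r v = if r == s then v else 0.
Proof.
move=> rT sT vs.
have T0 := period_gt0 tau; have T1 : T%:R != 0 :> C by rewrite pnatr_eq0 -lt0n.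
rewrite /sector_proj (eq_bigr (fun t : 'I_T =>
  expi (t%:R * (2 * pi * (s%:Z - r%:Z)%:~R / T%:R)) *: v)) => [|t _]; last first.
  rewrite (sector_iter _ vs) scalerA -expiD; congr (expi _ *: _).
  by rewrite natrM rmorphB /= -!pmulrn; field; rewrite pnatr_eq0 -lt0n.
rewrite -scaler_suml; case: eqVneq => [->|rs]; last first.
  by rewrite sum_expi ?scale0r ?scaler0 //; lia.
under eq_bigr do rewrite subrr mulr0 mul0r mulr0 expi0.
by rewrite sumr_const card_ord scalerA mulVf // scale1r.
Qed.

End Sectors.

(** * Truncation for arbitrary vectors and arbitrary complex base points *)

Section TwistedModes.
Variables (R : realType) (V : voa R) (T : nat) (tau : periodic_aut V T).
Local Notation C := R[i].
Variable M : twisted_module tau.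

Lemma fin0_sum (W : zmodType) n (F : 'I_n -> nat -> W) :
  (forall r, fin0 (F r)) -> fin0 (fun i => \sum_(r < n) F r i).
Proof.
move=> F0; have /fin_all_exists [N FN] := F0.
exists (\max_r N r) => i Ni; rewrite big1 // => r _.
by apply: FN; apply: leq_trans Ni; exact: leq_bigmax.
Qed.

Lemma sector_mode_fin0 (r : nat) u (al : C) (w : M) : (r < T)%N ->
  sector T tau r u -> fin0 (fun i => tmode u (al + i%:R) w).
Proof.
move=> rlt ur; have [[n ->]|aln] := pselect (exists n : int, al = rT R r T + n%:~R).
  have [N uN] := eventually0_ge (tmode_trunc w rlt ur) n; exists N => i /uN <-.
  by rewrite /coset rmorphD /= -pmulrn addrA.
exists 0%N => i _; apply: (tmode_support _ rlt ur) => n E; apply: aln.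
exists (n - i%:Z); rewrite rmorphB /= -pmulrn addrA -E addrK //.
Qed.

Lemma mode_fin0 u (al : C) (w : M) : fin0 (fun i => tmode u (al + i%:R) w).
Proof.
rewrite -(sector_proj_sum tau u).
have -> : (fun i => tmode (\sum_(r < T) sector_proj T tau r u) (al + i%:R) w)
  = fun i => \sum_(r < T) tmode (sector_proj T tau r u) (al + i%:R) w.
  apply/funext => i.
  exact: (@linfun_sum _ _ _ (fun v => tmode v (al + i%:R) w) _ _ (tmode_linearl _ _)).
by apply: fin0_sum => r; apply: sector_mode_fin0 => //; exact: sector_projP.
Qed.

End TwistedModes.

(** * Recurrence for the residues *)

Section Residues.
Variables (R : realType) (V : voa R) (T : nat) (tau : periodic_aut V T).
Local Notation C := R[i].
Variables M2 M3 : twisted_module tau.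
Implicit Type phi : series M2 M3.

(* coefficient of x^(-b-1) in the residue at x1 of
   x1^al ((x1-x)^n u(x1) phi(x) - (-x+x1)^n phi(x) u(x1)) *)
Definition res_comm (u : V) phi (n : int) (al b : C) (w : M2) : M3 :=
  res_left al u n phi b w - res_right al u n phi b w.

Section Recurrence.
Variable phi : series M2 M3.
Hypothesis phiL : forall a, linear (phi a).
Hypothesis phi0 : forall a w, eventually0 (coset a (fun b => phi b w)).

Lemma series_fin0 (b : C) w : fin0 (fun i => phi (b + i%:R) w).
Proof.
have [N pN] := eventually0_ge (phi0 b w) 0; exists N => i /pN.
by rewrite /coset add0r -pmulrn.
Qed.

Lemma left_fin0 u (c : nat -> C) (al : nat -> C) (b : C) w :
  fin0 (fun i => c i *: tmode u (al i) (phi (b + i%:R) w)).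
Proof.
have [N pN] := series_fin0 b w; exists N => i /pN ->.
by rewrite (linfun0 (tmode_linearr _ _)) scaler0.
Qed.

Lemma right_fin0 u (c : nat -> C) (b : nat -> C) (al : C) w :
  fin0 (fun i => c i *: phi (b i) (tmode u (al + i%:R) w)).
Proof.
have [N uN] := mode_fin0 u al w; exists N => i /uN ->.
by rewrite (linfun0 (phiL _)) scaler0.
Qed.

(** This is (x1-x)^(n+1) = x1 (x1-x)^n - x (x1-x)^n, read off from Pascal's rule: a factor x1 raises
    al, a factor x raises b. *)
Lemma res_leftD1 u n (al b : C) w :
  res_left al u (n + 1) phi b w
    = res_left (al + 1) u n phi b w - res_left al u n phi (b + 1) w.
Proof.
pose H i := (-1) ^+ i *: tmode u (al + (n + 1)%:~R - i%:R) (phi (b + i%:R) w).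
transitivity (\sum_(i \in [set: nat]) binc (n%:~R + 1) i *: H i).
  by apply: eq_fsbigr => i _; rewrite /H scalerA mulrC rmorphD.
have H0 : fin0 H by exact: left_fin0.
rewrite fsum_bincD1 //; congr (_ + _).
  apply: eq_fsbigr => i _; rewrite /H scalerA mulrC rmorphD /=.
  by congr (_ *: tmode u _ _); ring.
rewrite /res_left -fsumN; last exact: left_fin0.
apply: eq_fsbigr => i _; rewrite /H scalerA -scaleNr exprS -nat1r rmorphD /=.
congr (_ *: tmode u _ (phi _ w)); ring.
Qed.

Lemma res_rightD1 u n (al b : C) w :
  res_right al u (n + 1) phi b w
    = res_right (al + 1) u n phi b w - res_right al u n phi (b + 1) w.
Proof.
pose H i := (-1) ^ (n + 1 - i%:Z)
  *: phi (b + (n + 1)%:~R - i%:R) (tmode u (al + i%:R) w).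
transitivity (\sum_(i \in [set: nat]) binc (n%:~R + 1) i *: H i).
  by apply: eq_fsbigr => i _; rewrite /H scalerA mulrC rmorphD.
have H0 : fin0 H by exact: right_fin0.
(* Here the expansion is in powers of x1, so the shifted sum carries the factor x1 and the two
   Pascal terms trade places. *)
rewrite fsum_bincD1 // addrC; congr (_ + _).
  apply: eq_fsbigr => i _; rewrite /H scalerA mulrC -nat1r rmorphD /=.
  congr ((_ ^ _ * _) *: phi _ (tmode u _ w)); [lia|ring|ring].
rewrite /res_right -fsumN; last exact: right_fin0.
apply: eq_fsbigr => i _; rewrite /H scalerA -scaleNr rmorphD /=.
have -> : n + 1 - i%:Z = (n - i%:Z) + 1 by lia.
rewrite expfzDr ?oppr_eq0 ?oner_eq0 // expr1z.
congr (_ *: phi _ _); ring.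
Qed.

Lemma res_commD1 u n (al b : C) w :
  res_comm u phi (n + 1) al b w
    = res_comm u phi n (al + 1) b w - res_comm u phi n al (b + 1) w.
Proof.
by rewrite /res_comm res_leftD1 res_rightD1 !opprD addrACA.
Qed.

End Recurrence.

End Residues.

(* Multiplying by x1 - x relates the coefficient families of consecutive
   powers of x1; going down uses that D vanishes for n large. *)
Lemma recurrence_vanish (R : realType) (W : zmodType)
    (D : int -> R[i] -> R[i] -> W) (rho : R[i]) :
  (forall n al b, D (n + 1) al b = D n (al + 1) b - D n al (b + 1)) ->
  (exists N : int, forall n, N <= n -> forall al b, D n al b = 0) ->
  (forall n b, D n rho b = 0) ->
  forall (n m : int) b, D n (rho + m%:~R) b = 0.
Proof.
move=> DS [N DN] D0 n m b.
have up al : (forall n b, D n al b = 0) -> forall n b, D n (al + 1) b = 0.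
  move=> al0 {}n {}b; have := DS n al b.
  by rewrite !al0 subr0 => /esym.
have down al : (forall n b, D n (al + 1) b = 0) -> forall n b, D n al b = 0.
  (* Descending induction on n, with j an upper bound for the distance to N. *)
  move=> al1 {}n; have [j] : exists j : nat, N <= n + j%:Z by exists (absz (N - n)); lia.
  elim: j n => [|j IHj] n nj {}b; first by apply: DN; lia.
  have := DS n al (b - 1); rewrite al1 IHj; last lia.
  by rewrite sub0r subrK => /esym/eqP; rewrite oppr_eq0 => /eqP.
case: (intP m) n b => [|j|j].
- by rewrite addr0.
- elim: j.+1 => {j} [|j IHj]; first by rewrite addr0.
  by rewrite -addn1 PoszD rmorphD addrA; exact: up.
- elim: j.+1 => {j} [|j IHj]; first by rewrite oppr0 addr0.
  apply: down => n b; rewrite -[RHS](IHj n b); congr (D n _ b).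
  by rewrite -addn1 PoszD opprD rmorphD addrA subrK.
Qed.

(** * The Jacobi identity in terms of residues *)

Section Jacobi.
Variables (R : realType) (V : voa R) (T : nat) (tau : periodic_aut V T).
Local Notation C := R[i].
Variables M2 M3 : twisted_module tau.
Implicit Type phi : series M2 M3.

(** For k >= 0 both expansions of (x1-x)^k are the same polynomial; they match after reversing one
    index. This ties residues to weak commutativity. *)
Lemma res_comm_wcomm u phi (k : nat) (al b : C) w :
  res_comm u phi k%:Z al b w = wcomm u phi k al b w.
Proof.
have big i : (k.+1 <= i)%N -> binc (k%:Z)%:~R i = 0 :> C.
  by move=> ki; rewrite -pmulrn binc_nat bin_small.
rewrite /res_comm /res_left /res_right !(@fsum_trunc _ _ k.+1); last 2 first.
- by move=> i /big ->; rewrite mulr0 scale0r.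
- by move=> i /big ->; rewrite mulr0 scale0r.
rewrite [X in _ - X](reindex_inj rev_ord_inj) -sumrB /=; apply: eq_bigr => i _.
have ik : (i <= k)%N by rewrite -ltnS.
rewrite subSS -!pmulrn !binc_nat bin_sub // subzn ?leq_subr // -exprnP subKn //.
rewrite natrB // opprB !addrA scalerBr.
by congr (_ - _ *: phi _ _); rewrite addrAC addrK.
Qed.

(** The left side is the residue against x1^(rho+m), the right side (1+E)^(rho+m) applied to psi. In
    this form the base points enter only through rho + m and a + k. *)
Lemma jacobi_res_comm (rho a : C) u phi (psi : int -> series M2 M3) :
  jacobi rho (coset rho (tmode u)) (coset rho (tmode u)) (coset a phi)
    (fun q => coset (rho + a) (psi q)) <->
  forall (n m k : int) w, res_comm u phi n (rho + m%:~R) (a + k%:~R) w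
    = shift_sum (rho + m%:~R) (fun q c => psi q c w) n
        (rho + m%:~R + (a + k%:~R)).
Proof.
rewrite /jacobi /coset.
suff E n m k w : (\sum_(i \in [set: nat])
       ((-1) ^+ i * binc n%:~R i)
          *: tmode u (rho + (m + n - i%:Z)%:~R) (phi (a + (k + i%:Z)%:~R) w)
  - \sum_(i \in [set: nat])
       ((-1) ^ n * (-1) ^+ i * binc n%:~R i)
          *: phi (a + (k + n - i%:Z)%:~R) (tmode u (rho + (m + i%:Z)%:~R) w)
  = res_comm u phi n (rho + m%:~R) (a + k%:~R) w) /\
  (\sum_(i \in [set: nat])
       ((-1) ^+ i * binc (i%:R - (rho + m%:~R) - 1) i)
          *: psi (n + i%:Z) (rho + a + (m + k - i%:Z)%:~R) w
    = shift_sum (rho + m%:~R) (fun q c => psi q c w) n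
        (rho + m%:~R + (a + k%:~R))).
  by split=> H n m k w; have := H n m k w; have [-> ->] := E n m k w.
split.
  congr (_ - _); apply: eq_fsbigr => i _.
    rewrite !rmorphB !rmorphD /= -pmulrn.
    by congr (_ *: tmode u _ (phi _ w)); ring.
  rewrite !rmorphB !rmorphD /= -pmulrn expfzDr ?oppr_eq0 ?oner_eq0 //.
  rewrite -exprnN invr_sign.
  by congr (_ *: phi _ (tmode u _ w)); ring.
apply: eq_fsbigr => i _; rewrite binc_opp rmorphB rmorphD /= -pmulrn.
by congr (_ *: psi _ _ w); ring.
Qed.

End Jacobi.

(** * The action on H(M2,M3) and the Jacobi identity *)

Section Homomorphisms.
Variables (R : realType) (V : voa R) (T : nat) (tau : periodic_aut V T).
Local Notation C := R[i].
Variables M2 M3 : twisted_module tau.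
Implicit Type phi : series M2 M3.

Lemma res_comm_bounded u phi : is_generalized_intertwining phi ->
  exists N : int, forall n, N <= n -> forall al b w, res_comm u phi n al b w = 0.
Proof.
move=> [_ _ _ /(_ u) [k /wcommE kP]]; exists k%:Z => n kn al b w.
have -> : n = (absz n)%:Z by lia.
by rewrite res_comm_wcomm (wcomm_ge _ kP) //; lia.
Qed.

(* The case m = 0 of the Jacobi identity says that the residues are
   (1+E)^rho psi, and u_n^H phi is (1+E)^(-rho) applied to the residues. *)
Lemma sector_Hmode_jacobi (rho : C) u phi (psi : int -> series M2 M3) :
  is_generalized_intertwining phi ->
  (exists N : int, forall n, N <= n -> psi n = 0) ->
  (forall n, sector_Hmode rho u n phi = psi n) <->
  forall a : C,
    jacobi rho (coset rho (tmode u)) (coset rho (tmode u)) (coset a phi)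
      (fun q => coset (rho + a) (psi q)).
Proof.
move=> phiP [N0 psiN]; have [N phiN] := res_comm_bounded u phiP.
have [phiL phi0 _ _] := phiP.
have psi0 w : bounded_modes (fun q c => psi q c w).
  by exists N0 => n Nn b; rewrite psiN.
have res0 al w : bounded_modes (fun n c => res_comm u phi n al c w).
  by exists N => n Nn b; rewrite phiN.
(* The coefficients of x^(-rho) times the residue: with this shift u_n^H phi is exactly (1+E)^(-rho)
   applied to [g]. *)
pose g w n c := res_comm u phi n rho (c - rho) w.
have g0 w : bounded_modes (g w) by exists N => n Nn b; rewrite /g phiN.
have HE n b w : sector_Hmode rho u n phi b w = shift_sum (- rho) (g w) n b.
  by apply: eq_fsbigr => i _; rewrite /g (addrAC b).
split=> [H a|H n]; last first.
  apply/funext => b; apply/funext => w; rewrite HE.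
  have -> : g w = shift_sum rho (fun q c => psi q c w).
    apply/funext => {}n; apply/funext => c.
    (* Since the base point is arbitrary, m = k = 0 already reaches every coefficient. *)
    have /jacobi_res_comm/(_ n 0 0 w) := H (c - rho).
    by rewrite !addr0 subrKC.
  by rewrite shift_sum_comp // addNr shift_sum0.
apply/jacobi_res_comm => n m k w; apply/eqP; rewrite -subr_eq0; apply/eqP.
(* The difference of the two sides, with al for rho + m and b for a + k; the recurrence reduces it
   to al = rho. *)
pose D n al b := res_comm u phi n al b w
  - shift_sum al (fun q c => psi q c w) n (al + b).
rewrite -/(D n (rho + m%:~R) (a + k%:~R)).
apply: recurrence_vanish => {n m k} [n al b||n b]; rewrite /D.
- have E (X Y P Q : M3) : X - Y - Q = X - (P + Q) - (Y - P).
    by rewrite (addrC P Q) opprD addrA opprB addrA subrK addrAC.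
  (* Pascal's rule (1+E)^(al+1) = (1+E)^al + E (1+E)^al gives the right side the same recurrence as
     the residues. *)
  by rewrite res_commD1 // shift_sumD1 // (addrAC al 1 b) addrK addrA; exact: E.
- exists (Num.max N N0) => n; rewrite ge_max => /andP[Nn Pn] al b.
  rewrite phiN // /shift_sum (@fsum_trunc _ _ 0) ?big_ord0 ?subr0 // => i _.
  by rewrite psiN ?scaler0 //; lia.
- have -> : (fun q c => psi q c w) = shift_sum (- rho) (g w).
    by apply/funext => q; apply/funext => c; rewrite -H HE.
  by rewrite shift_sum_comp // addrN shift_sum0 // /g [rho + b]addrC addrK subrr.
Qed.

Lemma sector_Hmode0 rho n phi : (forall a, linear (phi a)) ->
  sector_Hmode rho 0 n phi = 0.
Proof.
move=> phiL; apply/funext => b; apply/funext => w.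
have z (F : nat -> M3) : F =1 (fun=> 0) -> \sum_(i \in [set: nat]) F i = 0.
  by move=> F0; rewrite fsbig1.
have t0 (N : twisted_module tau) a (x : N) : tmode 0 a x = 0.
  exact: (linfun0 (tmode_linearl _ _)).
rewrite /sector_Hmode z // => j; rewrite /res_left /res_right !z ?subrr ?scaler0 // => i.
- by rewrite t0 (linfun0 (phiL _)) scaler0.
- by rewrite t0 scaler0.
Qed.

Lemma Hmode_sector (s : nat) u n phi : (forall a, linear (phi a)) ->
  (s < T)%N -> sector T tau s u -> Hmode u n phi = sector_Hmode (rT R s T) u n phi.
Proof.
move=> phiL sT us; rewrite /Hmode (bigD1 (Ordinal sT)) //= big1 => [|r rs].
  by rewrite addr0 (sector_proj_id sT sT us) eqxx.
rewrite (sector_proj_id _ sT us) // ifN ?sector_Hmode0 //.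
Qed.

Lemma res_comm0 u phi (al b : C) w :
  res_comm u phi 0 al b w = tmode u al (phi b w) - phi b (tmode u al w).
Proof.
by rewrite (res_comm_wcomm u phi 0) /wcomm big_ord1 mulr1 scale1r !addr0 !subr0.
Qed.

(** At rho = 0 only j = 0 contributes, so L(-1) acts on H(M2,M3) as a commutator. This links the
    commutator condition on phi to the derivative property of I. *)
Lemma sector_Hmode_conf phi b w :
  sector_Hmode 0 conf 0 phi b w = tmode conf 0 (phi b w) - phi b (tmode conf 0 w).
Proof.
transitivity (\sum_(j \in [set: nat]) binc (0 : C) j
    *: res_comm conf phi (0 + j%:Z) 0 (b - 0 - j%:R) w).
  by rewrite /sector_Hmode oppr0.
rewrite (@fsum_trunc _ _ 1) => [|[|j] // _]; last by rewrite binc0S scale0r.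
by rewrite big_ord1 binc0 scale1r addr0 !subr0 res_comm0.
Qed.

End Homomorphisms.

(** * Intertwining operators and homomorphisms determine each other *)

Section IntertwiningOperators.
Variables (R : realType) (V : voa R) (T : nat) (tau : periodic_aut V T).
Local Notation C := R[i].
Variables (M2 M3 : twisted_module tau) (M : weak_module V).

Lemma modes_bounded (I : M -> series M2 M3) u w :
  (forall a x, linear (fun w => I w a x)) ->
  exists N : int, forall q, N <= q -> I (tmode u q%:~R w) = 0.
Proof.
move=> IM; have [N uN] := tmode_weak_eventually0 u w; exists N => q Nq.
by rewrite uN //; apply/funext => a; apply/funext => x; exact: (linfun0 (IM a x)).
Qed.

(** Once n passes the truncation bound of u_n w, the right side of the Jacobi identity vanishes and
    the left side is the weak commutator. For al off r/T + Z all modes of u involved are zero. *)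
Lemma sector_wcomm_eq0 (I : M -> series M2 M3) (r : nat) u w :
  is_intertwining I -> (r < T)%N -> sector T tau r u ->
  exists k : nat, forall al b x, wcomm u (I w) k al b x = 0.
Proof.
move=> [IM IL _ _ IJ] rlt ur; have [N IN] := modes_bounded u w IM.
exists (absz N) => al b x; rewrite -res_comm_wcomm.
have [[m ->]|aln] := pselect (exists m : int, al = rT R r T + m%:~R).
  have /jacobi_res_comm/(_ (absz N) m 0 x) := IJ r u ur w b.
  rewrite addr0 => ->; rewrite /shift_sum (@fsum_trunc _ _ 0) ?big_ord0 // => i _.
  by rewrite IN ?scaler0 //; lia.
have t0 (N' : twisted_module tau) i (y : N') :
    tmode u (al + (absz N)%:R - i%:R) y = 0.
  apply: (tmode_support _ rlt ur) => n E; apply: aln.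
  exists (n - (absz N)%:Z + i%:Z).
  by rewrite rmorphD rmorphB /= -!pmulrn !addrA -E; ring.
rewrite res_comm_wcomm /wcomm big1 // => i _.
by rewrite !t0 (linfun0 (IL _ _)) subrr scaler0.
Qed.

Lemma intertwining_generalized (I : M -> series M2 M3) : is_intertwining I ->
  forall w, is_generalized_intertwining (I w).
Proof.
move=> II w; have I0 := intertwining_eventually0 II.
have [IM IL _ ID IJ] := II; split=> //.
- move=> a x; rewrite -ID.
  have c0 : sector T tau 0 (conf (V := V)).
    by rewrite /sector mulr0 mul0r expi0 scale1r (aut_conf tau).
  (* With rho = n = m = 0 the left side is the commutator with L(-1) and the right side the single
     mode of I(L(-1)w, x). *)
  have /jacobi_res_comm/(_ 0 0 0 x) := IJ 0 _ c0 w a.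
  rewrite /rT mul0r !addr0 res_comm0 => ->.
  have [N IN] := modes_bounded conf w IM.
  rewrite shift_sum0 ?add0r //; exists N => n Nn b.
  by rewrite IN.
- move=> v.
  have /fin_all_exists [k kP] (r : 'I_T) : exists k : nat, forall al b x,
      wcomm (sector_proj T tau r v) (I w) k al b x = 0.
    by apply: sector_wcomm_eq0 => //; exact: sector_projP.
  (* The weak commutator is additive in v, and an exponent that works may be enlarged, so the
     maximum over the sectors serves v. *)
  exists (\max_r k r)%N; apply/wcommE => al b x.
  have -> : wcomm v (I w) (\max_r k r) al b x
     = \sum_(r < T) wcomm (sector_proj T tau r v) (I w) (\max_r k r) al b x.
    rewrite /wcomm exchange_big /=; apply: eq_bigr => i _.
    rewrite -scaler_sumr sumrB -{1 2}(sector_proj_sum tau v); congr (_ *: (_ - _)).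
      exact: (linfun_sum _ (tmode_linearl _ _)).
    rewrite -(linfun_sum _ (IL _ _)); congr (I w _ _).
    exact: (linfun_sum _ (tmode_linearl _ _)).
  rewrite big1 // => r _; apply: (wcomm_ge _ (kP r)); exact: leq_bigmax.
Qed.

Lemma intertwining_sector_Hmode (I : M -> series M2 M3) (r : nat) u n w :
  is_intertwining I -> (r < T)%N -> sector T tau r u ->
  sector_Hmode (rT R r T) u n (I w) = I (tmode u n%:~R w).
Proof.
move=> II rlt ur; have [IM _ _ _ IJ] := II.
have gP := intertwining_generalized II w.
have /(sector_Hmode_jacobi (rT R r T) u gP) [_] := modes_bounded u w IM.
by apply=> a; exact: IJ.
Qed.

Lemma intertwining_Hmode (I : M -> series M2 M3) u n w :
  is_intertwining I -> Hmode u n (I w) = I (tmode u n%:~R w).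
Proof.
move=> II; have [IM _ _ _ _] := II.
rewrite /Hmode (eq_bigr (fun r : 'I_T =>
  I (tmode (sector_proj T tau r u) n%:~R w))) => [|r _]; last first.
  by apply: intertwining_sector_Hmode => //; exact: sector_projP.
rewrite -[in RHS](sector_proj_sum tau u).
have -> : tmode (\sum_(r < T) sector_proj T tau r u) n%:~R w
    = \sum_(r < T) tmode (sector_proj T tau r u) n%:~R w.
  exact: (linfun_sum _ (tmode_linearl _ _)).
have IL : linear I.
  by move=> a w1 w2; apply/funext => b; apply/funext => x; exact: IM.
by rewrite (linfun_sum _ IL).
Qed.

(** Passes from 0 <= r < T to any integer r: a multiple of T added to r moves rho by an integer,
    which m absorbs. *)
Lemma jacobi_shift (rho a : C) (q : int) u phi (psi : int -> series M2 M3) :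
  jacobi rho (coset rho (tmode u)) (coset rho (tmode u)) (coset a phi)
    (fun q => coset (rho + a) (psi q)) ->
  jacobi (rho + q%:~R) (coset (rho + q%:~R) (tmode u))
    (coset (rho + q%:~R) (tmode u)) (coset a phi)
    (fun p => coset (rho + q%:~R + a) (psi p)).
Proof.
move=> /jacobi_res_comm J; apply/jacobi_res_comm => n m k x.
by have := J n (q + m) k x; rewrite rmorphD addrA.
Qed.

Lemma hom_intertwining (f : M -> Hspace M2 M3) :
  is_hom f -> is_intertwining (fun w => f w : series M2 M3).
Proof.
move=> [fL fH]; pose I w : series M2 M3 := f w.
have gP w : is_generalized_intertwining (I w).
  by apply/generalized_intertwiningP; exact: (valP (f w)).
have IM a x : linear (fun w => I w a x).
  by move=> c w w'; rewrite /I fL.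
have HI u n w : Hmode u n (I w) = I (tmode u n%:~R w) by rewrite /I fH.
split=> //.
- by move=> w; have [] := gP w.
- move=> w x c d d0; have [_ p0 _ _] := gP w.
  have d1 : d%:R != 0 :> C by rewrite pnatr_eq0 -lt0n.
  have d2 : 0 < d%:R :> rat by rewrite ltr0n.
  have /fin_all_exists [N NP] (j : 'I_d) : exists N : int, forall n, N <= n ->
      I w (c + j%:R / d%:R + n%:~R) x = 0 by exact: p0.
  (* Writing q = s/d + e with 0 <= s < d, only d cosets of Z occur. [P] dominates their bounds, and
     q >= P + 1 forces e >= P. *)
  pose P := (\max_j absz (N j))%N; exists P.+1%:R => q qP /intrP [z qE].
  have [s [e [sd zE]]] : exists s e, (s < d)%N /\ z = s%:Z + e * d%:Z.
    exists (absz (z %% d)%Z), (z %/ d)%Z.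
    have s0 : 0 <= (z %% d)%Z by rewrite modz_ge0 // eqz_nat -lt0n.
    rewrite gez0_abs // addrC -divz_eq; split=> //.
    by rewrite -ltz_nat gez0_abs // ltz_pmod // ltz_nat.
  have -> : c + ratr q = c + s%:R / d%:R + e%:~R.
    have -> : q = z%:~R / d%:R by rewrite -qE mulrC mulKf // gt_eqF.
    rewrite zE fmorph_div /= ratr_int ratr_nat rmorphD rmorphM /= -!pmulrn.
    by field.
  apply: (NP (Ordinal sd)).
  have Ps : (absz (N (Ordinal sd)) <= P)%N by exact: leq_bigmax.
  suff : P%:Z <= e by lia.
  have : (P.+1%:Z * d%:Z)%:~R <= z%:~R :> rat.
    by rewrite -qE rmorphM /= mulrC -!pmulrn ler_pM2l.
  rewrite ler_int zE; nia.
(* The derivative is a commutator with L(-1), hence the action of [conf] on H(M2,M3), which f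
   respects. *)
- move=> w a x; have [_ _ p1 _] := gP w; rewrite -p1 -sector_Hmode_conf.
  have c0 : sector T tau 0%N (conf (V := V)).
    by rewrite /sector mulr0 mul0r expi0 scale1r (aut_conf tau).
  have IL b : linear (I w b) by have [] := gP w.
  have := HI conf 0 w; rewrite (Hmode_sector 0 IL (period_gt0 tau) c0).
  by rewrite /rT mul0r => ->.
- move=> r u ur w a.
  have [s [q [sT us ->]]] := sector_modz (period_gt0 tau) ur.
  apply: jacobi_shift; move: a.
  have IN := modes_bounded u w IM.
  apply/(sector_Hmode_jacobi _ u (gP w) IN) => n.
  by rewrite -HI (Hmode_sector _ _ sT us) //; have [] := gP w.
Qed.

Lemma intertwining_hom (I : M -> series M2 M3) (f : M -> Hspace M2 M3) :
  is_intertwining I -> (forall w, f w = I w :> series M2 M3) -> is_hom f.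
Proof.
move=> II fI; have [IM _ _ _ _] := II; split.
  move=> a w w'; apply: val_inj; apply/funext => b; apply/funext => x.
  by rewrite /= !fI IM.
by move=> u n w; rewrite !fI intertwining_Hmode.
Qed.

End IntertwiningOperators.

(** * The linear isomorphism *)

Section Theta.
Variables (R : realType) (V : voa R) (T : nat) (tau : periodic_aut V T).
Variables (M2 M3 : twisted_module tau) (M : weak_module V).

Lemma IntertwinerP (I : Intertwiner M2 M3 M) : is_intertwining I.
Proof. by apply/intertwiningP; exact: (valP I). Qed.

Definition theta_fun (I : Intertwiner M2 M3 M) (w : M) : Hspace M2 M3 :=
  HSpace (introT (generalized_intertwiningP _)
    (intertwining_generalized (IntertwinerP I) w)).

Lemma theta_subproof I : theta_fun I \in Defs.hom (M2 := M2) (M3 := M3) (M := M).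
Proof. by apply/homP; apply: (intertwining_hom (IntertwinerP I)). Qed.

Definition theta (I : Intertwiner M2 M3 M) : HomV M2 M3 M :=
  MkHomV (theta_subproof I).

Lemma theta_linear : linear theta.
Proof.
move=> a I J; apply: val_inj; apply/funext => w; apply: val_inj.
by [].
Qed.

HB.instance Definition _ :=
  GRing.isLinear.Build _ (Intertwiner M2 M3 M) (HomV M2 M3 M) _ theta theta_linear.

Lemma HomVP (f : HomV M2 M3 M) : is_hom f.
Proof. by apply/homP; exact: (valP f). Qed.

Definition theta_inv (f : HomV M2 M3 M) : Intertwiner M2 M3 M :=
  IntertwinerV (introT (intertwiningP _) (hom_intertwining (HomVP f))).

(** Both maps keep the underlying family of series and change only the attached proofs, which
    [val_inj] discards. *)
Lemma theta_bij : bijective theta.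
Proof.
exists theta_inv => [I|f]; apply: val_inj => //.
by apply/funext => w; apply: val_inj.
Qed.

End Theta.

Theorem proposition4p8 (R : realType) (V : voa R) (T : nat)
    (tau : periodic_aut V T) (M2 M3 : twisted_module tau) (M : weak_module V) :
  (forall I : Intertwiner M2 M3 M,
     (forall w : M, is_generalized_intertwining (I w)) /\
     (forall f : M -> Hspace M2 M3,
        (forall w : M, f w = I w :> series M2 M3) -> is_hom f)) /\
  exists theta : {linear Intertwiner M2 M3 M -> HomV M2 M3 M},
    (forall I w, theta I w = I w :> series M2 M3) /\ bijective theta.
Proof.
split=> [I|].
  split; first exact: intertwining_generalized (IntertwinerP I).
  by move=> f; exact: intertwining_hom (IntertwinerP I).
by exists (@theta R V T tau M2 M3 M); split=> //; exact: theta_bij.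
Qed.
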